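(* Let $\mathcal{H}$ be a complex separable Hilbert space, let $\mathcal{K}$ and $\mathcal{E}$ be complex Krein spaces, and let $T:\mathcal{H}\to\mathcal{K}$ and $V:\mathcal{H}\to\mathcal{E}$ be bounded surjective linear operators such that $V^\#V$ is indefinite. Assume that $[Tu,Tu]_{\mathcal{K}}\ge 0$ for every $u\in\mathcal{H}$ with $[Vu,Vu]_{\mathcal{E}}=0$, and let $$\rho_-:=-\inf_{\{x\in\mathcal{H}:\ [Vx,Vx]_{\mathcal{E}}>0\}}\frac{[Tx,Tx]_{\mathcal{K}}}{[Vx,Vx]_{\mathcal{E}}},\qquad \rho_+:=-\sup_{\{x\in\mathcal{H}:\ [Vx,Vx]_{\mathcal{E}}<0\}}\frac{[Tx,Tx]_{\mathcal{K}}}{[Vx,Vx]_{\mathcal{E}}}.$$ If $\rho\in\mathbb{R}$ and $\rho\neq0$, then the following conditions are equivalent: (1) $T^\#T+\rho V^\#V\in\mathcal{L}(\mathcal{H})^+$; (2) $\rho\in[\rho_-,\rho_+]$; (3) $R(L)$ is a nonnegative subspace of $(\mathcal{K}\times\mathcal{E},[\cdot,\cdot]_\rho)$, where $L:\mathcal{H}\to\mathcal{K}\times\mathcal{E}$ is given by $Lx=(Tx,Vx)$ and $[(y,z),(y',z')]_\rho=[y,y']_{\mathcal{K}}+\rho[z,z']_{\mathcal{E}}$.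
   Context: A Krein space is a complex vector space $\mathcal{F}$ with a Hermitian sesquilinear form $[\cdot,\cdot]_{\mathcal{F}}$ that admits a fundamental decomposition $\mathcal{F}=\mathcal{F}_+\dotplus\mathcal{F}_-$, where $\mathcal{F}_+$ and $\mathcal{F}_-$ are orthogonal with respect to $[\cdot,\cdot]_{\mathcal{F}}$ and $(\mathcal{F}_+,[\cdot,\cdot])$, $(\mathcal{F}_-,-[\cdot,\cdot])$ are Hilbert spaces. Topological notions refer to the norm of the Hilbert space direct sum of these two spaces (the topology does not depend on the decomposition). For a bounded operator $T:\mathcal{H}\to\mathcal{K}$ from the Hilbert space $(\mathcal{H},\langle\cdot,\cdot\rangle)$ to the Krein space $\mathcal{K}$, $T^\#:\mathcal{K}\to\mathcal{H}$ is the bounded operator with $[Tx,y]_{\mathcal{K}}=\langle x,T^\#y\rangle$ for all $x,y$; $V^\#$ is defined similarly. $\mathcal{L}(\mathcal{H})^+$ is the set of bounded positive semidefinite operators on $\mathcal{H}$. $V^\#V$ is indefinite if it is neither positive nor negative semidefinite. $R(\cdot)$ denotes the range. A subspace $\mathcal{M}$ of an indefinite inner product space is nonnegative if $[x,x]\ge0$ for every $x\in\mathcal{M}$. Under the stated assumption, $\rho_\pm$ are well-defined real numbers with $\rho_-\le\rho_+$. *)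

(* Defs.v *)
From HB Require Import structures.
From mathcomp Require Import all_boot all_order all_algebra sesquilinear.
From mathcomp Require Import complex.
From mathcomp Require Import all_classical all_reals all_analysis.

Set Implicit Arguments.
Unset Strict Implicit.
Unset Printing Implicit Defensive.

Import Order.TTheory GRing.Theory Num.Theory.
Import numFieldNormedType.Exports.

Local Open Scope classical_set_scope.
Local Open Scope ring_scope.
Local Open Scope complex_scope.

(* Sesquilinear forms are linear in the first argument and conjugate-linear in
   the second. In [R[i]], [0 <= z] means that [z] is real and nonnegative. *)
Notation hermitian_form U := {hermitian U for false & Num.conj}.

Definition separable (T : topologicalType) : Prop :=
  exists2 D : set T, countable D & dense D.

(* A Hilbert space is a [completeNormedModType R[i]] whose norm is induced by an
   inner product. *)
Definition induces_norm (R : realType) (H : normedModType R[i])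
    (ip : {dot H for Num.conj}) : Prop :=
  forall x, `|x| ^+ 2 = ip x x.

Definition subspace (R : realType) (F : lmodType R[i]) (M : set F) : Prop :=
  submod_closed [in M].

Definition complete_subset (T : uniformType) (M : set T) : Prop :=
  forall G : set_system T, ProperFilter G -> cauchy G -> G M ->
    exists2 x, M x & G --> x.

(* [(M, g)] is a Hilbert space whose norm is the restriction of the ambient one.
   In particular [g] is positive definite on [M]. *)
Definition hilbert_subspace (R : realType) (F : normedModType R[i])
    (g : F -> F -> R[i]) (M : set F) : Prop :=
  [/\ subspace M, forall x, M x -> `|x| ^+ 2 = g x x & complete_subset M].

(* The last clause says that the norm carried by [F] is the norm of the Hilbert
   space direct sum of [(Fp, f)] and [(Fm, - f)]. *)
Definition fundamental_decomposition (R : realType) (F : normedModType R[i])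
    (f : hermitian_form F) (Fp Fm : set F) : Prop :=
  [/\ hilbert_subspace f Fp,
      hilbert_subspace (fun x y => - f x y) Fm,
      forall x y, Fp x -> Fm y -> f x y = 0,
      forall x, exists! p : F * F, [/\ Fp p.1, Fm p.2 & x = p.1 + p.2] &
      forall x y, Fp x -> Fm y -> `|x + y| ^+ 2 = `|x| ^+ 2 + `|y| ^+ 2].

(* A Krein space is a complex vector space with a Hermitian form admitting a
   fundamental decomposition. The norm of one such decomposition is made part of
   the type [F], so that the library's topological notions apply; the resulting
   topology does not depend on the decomposition. *)
Definition krein_space (R : realType) (F : normedModType R[i])
    (f : hermitian_form F) : Prop :=
  exists Fp Fm : set F, fundamental_decomposition f Fp Fm.

(* Bounded linear operators are the continuous linear maps, see
   [linear_bounded_continuous]. *)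
Definition is_adjoint (R : realType) (H F : normedModType R[i])
    (ip : {dot H for Num.conj}) (f : hermitian_form F)
    (T : H -> F) (S : F -> H) : Prop :=
  [/\ linear S, continuous S & forall x y, f (T x) y = ip x (S y)].

(* [T^#]; when [H] is a Hilbert space, [F] a Krein space and [T] bounded, there
   is exactly one such [S], by the Riesz representation theorem. *)
Definition adjoint (R : realType) (H F : normedModType R[i])
    (ip : {dot H for Num.conj}) (f : hermitian_form F) (T : H -> F) : F -> H :=
  xget (fun=> 0) [set S | is_adjoint ip f T S].

Definition psd (R : realType) (H : normedModType R[i])
    (ip : {dot H for Num.conj}) (A : H -> H) : Prop :=
  forall x, 0 <= ip (A x) x.

Definition nsd (R : realType) (H : normedModType R[i])
    (ip : {dot H for Num.conj}) (A : H -> H) : Prop :=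
  forall x, ip (A x) x <= 0.

Definition indefinite (R : realType) (H : normedModType R[i])
    (ip : {dot H for Num.conj}) (A : H -> H) : Prop :=
  ~ psd ip A /\ ~ nsd ip A.

(* Membership in L(H)^+. *)
Definition positive_operator (R : realType) (H : normedModType R[i])
    (ip : {dot H for Num.conj}) (A : H -> H) : Prop :=
  [/\ linear A, continuous A & psd ip A].

(* [complex.Re] only serves to land in [R]: both forms are real on the diagonal. *)
Definition form_ratio (R : realType) (H K E : normedModType R[i])
    (fK : hermitian_form K) (fE : hermitian_form E)
    (T : H -> K) (V : H -> E) (x : H) : R :=
  complex.Re (fK (T x) (T x) / fE (V x) (V x)).

Definition rho_minus (R : realType) (H K E : normedModType R[i])
    (fK : hermitian_form K) (fE : hermitian_form E)
    (T : H -> K) (V : H -> E) : R :=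
  - inf [set form_ratio fK fE T V x | x in [set x | 0 < fE (V x) (V x)]].

Definition rho_plus (R : realType) (H K E : normedModType R[i])
    (fK : hermitian_form K) (fE : hermitian_form E)
    (T : H -> K) (V : H -> E) : R :=
  - sup [set form_ratio fK fE T V x | x in [set x | fE (V x) (V x) < 0]].

Definition prod_form (R : realType) (K E : lmodType R[i])
    (fK : hermitian_form K) (fE : hermitian_form E) (rho : R)
    (p q : K * E) : R[i] :=
  fK p.1 q.1 + rho%:C * fE p.2 q.2.

Definition nonnegative_subspace (R : realType) (F : lmodType R[i])
    (f : F -> F -> R[i]) (M : set F) : Prop :=
  subspace M /\ forall x, M x -> 0 <= f x x.

(* Main.v *)
(* With q(x) = [Tx,Tx] and p(x) = [Vx,Vx], conditions (1) and (3) both say that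
   q + rho p >= 0, once the adjoints are known to exist: a Krein space form is
   bounded, so the Riesz representation theorem applies. That (2) says the same
   rests on q(y)/p(y) <= q(x)/p(x) whenever p(y) < 0 < p(x), which makes the
   infimum and the supremum finite; the neutral vectors, p(x) = 0, are covered by
   the hypothesis on T. *)
Require Import Defs.
From HB Require Import structures.
From mathcomp Require Import all_boot all_order all_algebra sesquilinear.
From mathcomp Require Import complex.
From mathcomp Require Import all_classical all_reals all_analysis.
From mathcomp Require Import ring lra.

Set Implicit Arguments.
Unset Strict Implicit.
Unset Printing Implicit Defensive.

Import Order.TTheory GRing.Theory Num.Theory.
Import numFieldNormedType.Exports.

Local Open Scope classical_set_scope.
Local Open Scope ring_scope.
Local Open Scope complex_scope.

(** * Algebra of Hermitian forms *)

Lemma hermitian_sym (R : realType) (F : lmodType R[i]) (f : hermitian_form F) x y :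
  f x y = conjc (f y x).
Proof. by rewrite hermC expr0 mul1r. Qed.

Lemma hermitian_diag (R : realType) (F : lmodType R[i]) (f : hermitian_form F) x :
  f x x = (complex.Re (f x x))%:C.
Proof.
have := hermitian_sym f x x.
by case: (f x x) => a b [] b0; congr (_ +i* _); lra.
Qed.

Lemma hermitian_sqrD (R : realType) (F : lmodType R[i]) (f : hermitian_form F)
    x y (t : R) :
  complex.Re (f (x + t%:C *: y) (x + t%:C *: y)) =
  complex.Re (f x x) + 2 * t * complex.Re (f x y) + t ^+ 2 * complex.Re (f y y).
Proof.
rewrite linearDl 2!linearDr /= !linearZr_LR /= !linearZl_LR /= (hermitian_sym f y x).
have -> : Num.conj t%:C = t%:C by exact: conjc_real.
case: (f x x) (f x y) (f y y) => [a a'] [b b'] [c c'] /=.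
by rewrite /GRing.scale /=; ring.
Qed.

Lemma hermitian_sqrZ (R : realType) (F : lmodType R[i]) (f : hermitian_form F)
    x (c : R[i]) :
  f (c *: x) (c *: x) = `|c| ^+ 2 * f x x.
Proof. by rewrite linearZr_LR /= linearZl_LR /= mulrA sqr_normc [c * _]mulrC. Qed.

(** * Boundedness of the form of a Krein space *)

(** Expand [g z z >= 0] at [z = x - (g x y / g y y) y], which stays in the subspace [M], where
    [g z z] is a squared norm. [g] is a bare function so that the result also covers the negated
    form on the negative summand. *)
Lemma CauchySchwarz_hilbert_subspace (R : realType) (F : normedModType R[i])
    (g : F -> F -> R[i]) (M : set F) :
  (forall y, linear_for *%R (g^~ y)) -> (forall x y, g x y = conjc (g y x)) ->
  hilbert_subspace g M ->
  forall x y, M x -> M y -> `|g x y| <= `|x| * `|y|.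
Proof.
move=> gl gs [[_ Msub] Mg _] x y Mx My.
have gB a u v w : g (a *: u + v) w = a * g u w + g v w by exact: gl.
have gBr a u v w : g w (a *: u + v) = conjc a * g w u + g w v.
  by rewrite gs gB rmorphD rmorphM /= -!gs.
have g0 w : g w 0 = 0.
  by rewrite -[X in g w X](addNr w) -scaleN1r gBr rmorphN rmorph1 mulN1r addNr.
have [->|y0] := eqVneq y 0; first by rewrite g0 normr0 normr0 mulr0.
have gy_gt0 : 0 < g y y by rewrite -Mg// exprn_gt0// normr_gt0.
pose c : R[i] := - (g x y / g y y).
have : M (c *: y + x).
  by apply: set_mem; exact: (Msub c y x (mem_set My) (mem_set Mx)).
move=> /Mg; rewrite !(gB, gBr) => gz.
have gyC : conjc (g y y) = g y y by rewrite -gs.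
have cC : conjc c = - (g y x / g y y).
  by rewrite /c rmorphN rmorphM fmorphV /= -!gs.
have : 0 <= g x x - `|g x y| ^+ 2 / g y y.
  rewrite sqr_normc -gs.
  have -> : g x x - g x y * g y x / g y y =
      c * (conjc c * g y y + g y x) + (conjc c * g x y + g x x).
    by rewrite cC /c; field; rewrite gt_eqF.
  by rewrite -gz exprn_ge0.
rewrite subr_ge0 ler_pdivrMr// => gxy.
rewrite -(@ler_pXn2r _ 2) ?nnegrE ?mulr_ge0// exprMn.
by rewrite (Mg x)// (Mg y).
Qed.

(** Orthogonality of the two summands removes the cross terms, Cauchy-Schwarz bounds what is left on
    each summand, and Pythagoras bounds the components by the whole vector. The factor 2 comes from
    adding the two bounds. *)
Lemma krein_bounded (R : realType) (F : normedModType R[i]) (f : hermitian_form F) :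
  krein_space f -> forall x y, `|f x y| <= 2 * `|x| * `|y|.
Proof.
move=> [Fp [Fm [Fp_hilb Fm_hilb orth dec pyth]]] x y.
have [[x1 x2] [/= [x1p x2m ->] _]] := dec x.
have [[y1 y2] [/= [y1p y2m ->] _]] := dec y.
have -> : f (x1 + x2) (y1 + y2) = f x1 y1 + f x2 y2.
  rewrite linearDl 2!linearDr /= (orth x1 y2)// (hermitian_sym f x2 y1) (orth y1 x2)//.
  by rewrite conjc0 addr0 add0r.
have le1 u v : Fp u -> Fm v -> `|u| <= `|u + v|.
  move=> up vm; rewrite -(@ler_pXn2r _ 2) ?nnegrE// pyth//.
  by rewrite lerDl exprn_ge0.
have le2 u v : Fp u -> Fm v -> `|v| <= `|u + v|.
  move=> up vm; rewrite -(@ler_pXn2r _ 2) ?nnegrE// pyth//.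
  by rewrite lerDr exprn_ge0.
have bp : `|f x1 y1| <= `|x1| * `|y1|.
  apply: (CauchySchwarz_hilbert_subspace _ _ Fp_hilb) => //.
    by move=> v a u w; rewrite linearPl.
  exact: hermitian_sym.
have bm : `|f x2 y2| <= `|x2| * `|y2|.
  rewrite -[`|f x2 y2|]normrN.
  apply: (CauchySchwarz_hilbert_subspace _ _ Fm_hilb) => //.
    by move=> v a u w; rewrite linearPl opprD mulrN.
  by move=> u v; rewrite hermitian_sym rmorphN.
rewrite (le_trans (ler_normD _ _))// -mulrA mulr_natl mulr2n lerD//.
  by apply: (le_trans bp); apply: ler_pM; rewrite ?le1.
by apply: (le_trans bm); apply: ler_pM; rewrite ?le2.
Qed.

(** * Riesz representation *)

Lemma normr_Re (R : rcfType) (F : normedZmodType R[i]) (x : F) :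
  `|x| = (complex.Re `|x|)%:C.
Proof. by rewrite RRe_real// ger0_real. Qed.

Lemma Re_norm_ge0 (R : rcfType) (F : normedZmodType R[i]) (x : F) :
  0 <= complex.Re `|x|.
Proof. by rewrite -ler0c -normr_Re normr_ge0. Qed.

(** First-order condition at a minimum: the linear coefficient of the increment vanishes. *)
Lemma quadratic_ge0_linear_eq0 (R : realFieldType) (a b : R) :
  (forall t, 0 <= 2 * t * a + t ^+ 2 * b) -> a = 0.
Proof.
move=> ge0; have b0 : 0 <= b by have := ge0 1; have := ge0 (-1); lra.
(* The minimizer would be [- a / b]; using [b + 1] avoids a separate case [b = 0]. *)
have := ge0 (- a / (b + 1)).
have -> : 2 * (- a / (b + 1)) * a + (- a / (b + 1)) ^+ 2 * b =
    - (a ^+ 2 * (b + 2) / (b + 1) ^+ 2) by field; lra.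
rewrite oppr_ge0 pmulr_lle0 ?invr_gt0 ?exprn_gt0//; last by lra.
rewrite pmulr_lle0; last by lra.
by move=> a2; apply/eqP; rewrite -sqrf_eq0 eq_le a2 sqr_ge0.
Qed.

(* The representing vector minimizes [|x|^2 - 2 Re phi x]: by the parallelogram
   law the sublevel sets of this functional generate a Cauchy filter. *)
Lemma riesz_representation (R : realType) (H : completeNormedModType R[i])
    (ip : {dot H for Num.conj}) (phi : H -> R[i]) (M : R[i]) :
  induces_norm ip -> linear_for *%R phi -> 0 <= M ->
  (forall x, `|phi x| <= M * `|x|) ->
  exists y, forall x, phi x = ip x y.
Proof.
move=> ipH phil M0 phiM.
(* Norms and forms take values in [R[i]]; [n], [g] and [l] are real counterparts, open to real
   arithmetic. *)
pose n (x : H) := complex.Re `|x|.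
have nE x : `|x| = (n x)%:C := normr_Re x.
have n0 x : 0 <= n x := Re_norm_ge0 x.
pose g x y := complex.Re (ip x y); pose l x := complex.Re (phi x).
have gnn x : g x x = n x ^+ 2.
  by rewrite /g -ipH nE -rmorphXn.
have gD x y t : g (x + t%:C *: y) (x + t%:C *: y) =
  g x x + 2 * t * g x y + t ^+ 2 * g y y by exact: hermitian_sqrD.
have nD x y t : n (x + t%:C *: y) ^+ 2 =
    n x ^+ 2 + 2 * t * g x y + t ^+ 2 * n y ^+ 2 by rewrite -!gnn gD.
have lD x y t : l (x + t%:C *: y) = l x + t * l y.
  rewrite /l addrC phil; case: (phi x) (phi y) => [a a'] [b b'] /=.
  by rewrite mul0r subr0 addrC.
have [m m0 lm] : exists2 m, 0 <= m & forall x, `|l x| <= m * n x.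
  have ME : M = (complex.Re M)%:C by rewrite RRe_real// ger0_real.
  exists (complex.Re M); first by rewrite -ler0c -ME.
  move=> x; rewrite -lecR rmorphM /= -ME -nE.
  exact: le_trans (normc_ge_Re _) (phiM x).
pose J x := n x ^+ 2 - 2 * l x.
have JD x y t : J (x + t%:C *: y) =
    J x + 2 * t * (g x y - l y) + t ^+ 2 * n y ^+ 2.
  by rewrite /J nD lD; ring.
(* [J x >= n x ^+ 2 - 2 * m * n x = (n x - m) ^+ 2 - m ^+ 2]. *)
have Jlb x : - m ^+ 2 <= J x.
  rewrite /J; have := lm x; rewrite ler_norml => /andP[_ lx].
  by have := sqr_ge0 (n x - m); rewrite sqrrB => ?; lra.
have Jhas : has_inf (range J).
  by split; [exists (J 0), 0|exists (- m ^+ 2) => _ [x _ <-]].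
pose j := inf (range J).
have jJ x : j <= J x by apply: (ge_inf Jhas.2); exists x.
(* At the midpoint [z] of [x] and [y], [n (y - x) ^+ 2 = 2 * (J x + J y - 2 * J z)], and
   [J z >= j]. *)
have par x y : n (y - x) ^+ 2 <= 2 * (J x + J y - 2 * j).
  have yE : y = x + 1%:C *: (y - x) by rewrite scale1r addrC subrK.
  have := jJ (x + (2^-1)%:C *: (y - x)).
  by rewrite [in J y]yE !JD; lra.
pose B d := [set x | J x < j + d].
pose F := filter_from [set d : R | 0 < d] B.
have BF d : 0 < d -> F (B d) by exists d.
have FF : ProperFilter F.
  apply: filter_from_proper.
    apply: filter_from_filter; first by exists 1 => /=.
    move=> d e /= d0 e0; exists (Num.min d e) => /=; first by rewrite lt_min d0.
    by move=> x; rewrite /B /= /Num.min; case: ifP => de xJ; split => /=; lra.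
  move=> d /= d0; have [_ [x _ <-] xJ] := inf_adherent d0 Jhas.
  by exists x.
have Fcauchy : cauchy F.
  apply: cauchy_exP => eps eps0.
  have eE : eps = (complex.Re eps)%:C by rewrite RRe_real// gtr0_real.
  set e := complex.Re eps in eE.
  have e0 : 0 < e by rewrite -ltcR -eE.
  (* By [par], two points of [B d] have squared distance below [4 * d]. *)
  have d0 : 0 < e ^+ 2 / 4 by rewrite divr_gt0 ?exprn_gt0.
  have [x Bx] := filter_ex (BF _ d0).
  exists x; apply: filterS (BF _ d0) => y By.
  rewrite -ball_normE /ball_ /= -normrN opprB nE eE ltcR.
  rewrite -(@ltr_pXn2r _ 2) ?nnegrE ?n0 ?ltW//.
  by rewrite (le_lt_trans (par x y))//; move: Bx By; rewrite /B /=; lra.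
have Fcvg := cauchy_cvg F Fcauchy.
set y := lim F in Fcvg.
have Jy : J y = j.
  apply/eqP; rewrite eq_le jJ andbT; apply/ler_addgt0Pr => d d0.
  (* [J y - J x <= 2 * (n y + m) * n (x - y)]; the added 1 keeps [c] positive. *)
  set c := 2 * (n y + m) + 1.
  have c0 : 0 < c by have := n0 y; rewrite /c; lra.
  have d2 : 0 < d / 2 by rewrite divr_gt0.
  have Fb : F (ball y (d / 2 / c)%:C).
    by apply: Fcvg; apply: nbhsx_ballx; rewrite -[0]/(0%:C) ltcR divr_gt0.
  have [x [xy xJ]] := filter_ex (filterI Fb (BF _ d2)).
  have nxy : n (x - y) * c <= d / 2.
    move: xy; rewrite -ball_normE /ball_ /= -normrN opprB nE ltcR.
    by rewrite -ler_pdivlMr// => /ltW.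
  have tri : n y <= n x + n (x - y).
    rewrite -lecR rmorphD /= -!nE -[`|x - y|]normrN opprB.
    by rewrite -{1}(subrK x y) addrC ler_normD.
  have lxy : l x = l y + l (x - y).
    by rewrite -[l (x - y)]mul1r -lD scale1r addrC subrK.
  have := lm (x - y); rewrite ler_norml => /andP[_ lxy_le].
  move: xJ; rewrite /B /J /= lxy => xJ.
  have nn : n y ^+ 2 <= n x ^+ 2 + 2 * n y * n (x - y).
    have := sqr_ge0 (n y - n x); have := n0 y; nra.
  have := n0 (x - y); move: nxy; rewrite /c; nra.
have gl x : g y x = l x.
  apply/subr0_eq/(@quadratic_ge0_linear_eq0 _ _ (n x ^+ 2)) => t.
  by have := jJ (y + t%:C *: x); rewrite JD Jy; lra.
have phi0 : phi 0 = 0.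
  have := phil 1 0 0; rewrite scaler0 addr0 mul1r => /eqP.
  by rewrite -[X in X == _]addr0 (inj_eq (addrI _)) eq_sym => /eqP.
exists y => x.
have ipS : ip x y = conjc (ip y x) := hermitian_sym ip x y.
(* [gl] identifies real parts only; its instance at ['i *: x] gives the imaginary parts. *)
have := gl x; have := gl ('i *: x); rewrite /g /l linearZr_LR /= ipS.
have -> : phi ('i *: x) = 'i * phi x.
  by have := phil 'i x 0; rewrite phi0 !addr0.
case: (phi x) (ip y x) => [a a'] [b b'] /=.
rewrite !(mul0r, mul1r, sub0r) /= => h1 h2.
apply/eqP; rewrite eq_complex /=; apply/andP; split; apply/eqP; lra.
Qed.

(** * Existence of the adjoint *)

(** For each [y], Riesz represents the bounded functional [f (T x) y] of [x]; definiteness of [ip]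
    makes the representing vector linear in [y]. Since [adjoint] selects by [xget], exhibiting one
    adjoint is enough. *)
Lemma adjointP (R : realType) (H : completeNormedModType R[i]) (F : normedModType R[i])
    (ip : {dot H for Num.conj}) (f : hermitian_form F) (T : {linear H -> F}) :
  induces_norm ip -> krein_space f -> continuous T ->
  is_adjoint ip f T (adjoint ip f T).
Proof.
move=> ipH fK Tc.
have fb := krein_bounded fK.
have [C C0 TC] : exists2 C : R[i], 0 < C & forall x, `|T x| <= C * `|x|.
  move/linear_bounded_continuous/linear_boundedP: Tc => /pinfty_ex_gt0[C C0 TC].
  by exists C.
have fTb x y : `|f (T x) y| <= 2 * C * `|y| * `|x|.
  apply: (le_trans (fb _ _)); rewrite -!mulrA ler_pM2l//.
  by rewrite [`|y| * _]mulrC mulrA ler_wpM2r.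
have S_ex y : exists z, forall x, f (T x) y = ip x z.
  apply: (@riesz_representation _ _ _ (fun x => f (T x) y) (2 * C * `|y|)) => //.
    by move=> a u v; rewrite linearP linearPl.
  by rewrite !mulr_ge0// ltW.
have [S Sf] := choice S_ex.
have ip_inj u v : (forall x, ip x u = ip x v) -> u = v.
  move=> uv; apply/eqP; rewrite -subr_eq0 -(dnorm_eq0 ip).
  by rewrite linearBr /= uv subrr.
have Slin : linear S.
  move=> a u v; apply: ip_inj => x.
  by rewrite -Sf !linearPr /= !Sf.
have Sb y : `|S y| <= 2 * C * `|y|.
  have [->|Sy0] := eqVneq (S y) 0; first by rewrite normr0 !mulr_ge0// ltW.
  (* Test with [x = S y]: the squared norm of [S y] is [f (T (S y)) y], so one factor can be
     cancelled. *)
  rewrite -(@ler_pM2r _ `|S y|) ?normr_gt0// -expr2 ipH -Sf.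
  apply: le_trans (fTb (S y) y).
  by rewrite real_ler_norm// Sf -ipH ger0_real// exprn_ge0.
pose SL : {linear F -> H} := HB.pack S (GRing.isLinear.Build _ _ _ _ S Slin).
have Sc : continuous SL.
  apply: bounded_linear_continuous; apply/bounded_funP => r.
  exists (2 * C * r) => y yr; apply: (le_trans (Sb y)).
  by rewrite ler_wpM2l// mulr_ge0// ltW.
by apply: (@xgetPex _ (fun=> 0) [set S | is_adjoint ip f T S]); exists S; split.
Qed.

(** * Comparison of the ratios on positive and negative vectors *)

(* Rotating [y] so that [V y] becomes orthogonal to [V x] in real part, the
   vectors [x + s y] and [x - s y] are both neutral for a suitable [s]; adding
   the two inequalities given by the hypothesis cancels the cross terms. *)
Lemma form_ratio_le (R : realType) (H K E : normedModType R[i])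
    (fK : hermitian_form K) (fE : hermitian_form E)
    (T : {linear H -> K}) (V : {linear H -> E}) (x y : H) :
  (forall u, fE (V u) (V u) = 0 -> 0 <= fK (T u) (T u)) ->
  0 < fE (V x) (V x) -> fE (V y) (V y) < 0 ->
  form_ratio fK fE T V y <= form_ratio fK fE T V x.
Proof.
move=> T_nonneg.
pose q u := complex.Re (fK (T u) (T u)); pose p u := complex.Re (fE (V u) (V u)).
have qE u : fK (T u) (T u) = (q u)%:C := hermitian_diag _ _.
have pE u : fE (V u) (V u) = (p u)%:C := hermitian_diag _ _.
have ratioE u : form_ratio fK fE T V u = q u / p u.
  by rewrite /form_ratio qE pE -fmorphV -rmorphM.
rewrite !ratioE !pE -[0]/(0%:C) !ltcR => px py.
have [c c0 cxy] : exists2 c : R[i], c != 0 & complex.Re (fE (V x) (V (c *: y))) = 0.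
  have [z0|z0] := eqVneq (fE (V x) (V y)) 0.
    by exists 1; rewrite ?oner_eq0// scale1r z0.
  (* Conjugate-linearity in the second argument turns the product into [- 'i] times a squared
     modulus, which is purely imaginary. *)
  exists ('i * fE (V x) (V y)).
    by rewrite mulf_neq0// eq_complex /= oner_eq0 andbF.
  rewrite linearZ linearZr_LR /=.
  by case: (fE _ _) => a b /=; lra.
pose k := complex.Re `|c| ^+ 2.
have k0 : 0 < k by rewrite exprn_gt0// -ltcR -normr_Re normr_gt0.
have qZ : q (c *: y) = k * q y.
  apply: complexI; rewrite -qE linearZ hermitian_sqrZ qE rmorphM rmorphXn.
  by rewrite [in LHS]normr_Re.
have pZ : p (c *: y) = k * p y.
  apply: complexI; rewrite -pE linearZ hermitian_sqrZ pE rmorphM rmorphXn.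
  by rewrite [in LHS]normr_Re.
have pZ_lt0 : p (c *: y) < 0 by rewrite pZ pmulr_rlt0.
(* The root of [p x + s ^+ 2 * p (c *: y) = 0]; the radicand is positive because the two values of
   [p] have opposite signs. *)
pose s := Num.sqrt (p x / - p (c *: y)).
have s2 : s ^+ 2 * p (c *: y) = - p x.
  rewrite sqr_sqrtr; first by field; rewrite lt_eqF.
  by apply: divr_ge0; rewrite ?oppr_ge0 ltW.
have q_ge0 t : t ^+ 2 = s ^+ 2 ->
    0 <= q x + 2 * t * complex.Re (fK (T x) (T (c *: y))) + s ^+ 2 * q (c *: y).
  move=> ts; rewrite -ts -hermitian_sqrD -ler0c -linearZ -linearD -qE.
  apply: T_nonneg; rewrite pE /p linearD linearZ hermitian_sqrD cxy.
  by rewrite mulr0 addr0 ts -/(p _) s2 subrr.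
(* Rotation and scaling by [c] multiply [q] and [p] by the same [k]. *)
have -> : q y / p y = q (c *: y) / p (c *: y).
  by rewrite qZ pZ; field; rewrite lt_eqF// gt_eqF.
rewrite ler_pdivlMr// -[p x]opprK -s2.
have -> : q (c *: y) / p (c *: y) * - (s ^+ 2 * p (c *: y)) = - (s ^+ 2 * q (c *: y)).
  by field; rewrite lt_eqF.
by have := q_ge0 s erefl; have := q_ge0 (- s) (sqrrN _); lra.
Qed.

(** * Equivalence of positivity, the interval condition and nonnegativity of the range *)

Theorem corollary3p2 (R : realType)
    (H : completeNormedModType R[i]) (ip : {dot H for Num.conj})
    (K E : normedModType R[i])
    (fK : hermitian_form K) (fE : hermitian_form E)
    (T : {linear H -> K}) (V : {linear H -> E}) (rho : R)
    (H_hilbert : induces_norm ip) (H_separable : separable H)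
    (K_krein : krein_space fK) (E_krein : krein_space fE)
    (T_bounded : continuous T) (T_surj : set_surj setT setT T)
    (V_bounded : continuous V) (V_surj : set_surj setT setT V)
    (V_indefinite : indefinite ip (adjoint ip fE V \o V))
    (T_nonneg : forall u : H, fE (V u) (V u) = 0 -> 0 <= fK (T u) (T u))
    (rho_neq0 : rho != 0) :
  [<-> positive_operator ip
         (fun x => adjoint ip fK T (T x) + rho%:C *: adjoint ip fE V (V x));
       rho_minus fK fE T V <= rho <= rho_plus fK fE T V;
       nonnegative_subspace (prod_form fK fE rho)
         (range (fun x : H => (T x, V x)))].
Proof.
have [TSlin TSc TS] := adjointP H_hilbert K_krein T_bounded.
have [VSlin VSc VS] := adjointP H_hilbert E_krein V_bounded.
pose q u := complex.Re (fK (T u) (T u)); pose p u := complex.Re (fE (V u) (V u)).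
have qE u : fK (T u) (T u) = (q u)%:C := hermitian_diag _ _.
have pE u : fE (V u) (V u) = (p u)%:C := hermitian_diag _ _.
have ratioE u : form_ratio fK fE T V u = q u / p u.
  by rewrite /form_ratio qE pE -fmorphV -rmorphM.
have ipS u v : ip u v = conjc (ip v u) := hermitian_sym ip u v.
have ipD a u v w : ip (u + a *: v) w = ip u w + a * ip v w.
  by rewrite linearDl /= linearZl_LR.
have ipTS x : ip (adjoint ip fK T (T x)) x = (q x)%:C.
  by rewrite ipS -TS qE conjc_real.
have ipVS x : ip (adjoint ip fE V (V x)) x = (p x)%:C.
  by rewrite ipS -VS pE conjc_real.
have prodE x : prod_form fK fE rho (T x, V x) (T x, V x) = (q x + rho * p x)%:C.
  by rewrite /prod_form /= qE pE rmorphD rmorphM.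
have sumE x : ip (adjoint ip fK T (T x) + rho%:C *: adjoint ip fE V (V x)) x =
    (q x + rho * p x)%:C.
  by rewrite ipD ipTS ipVS rmorphD rmorphM.
have q_ge0 u : p u = 0 -> 0 <= q u.
  by move=> pu; rewrite -ler0c -qE; apply: T_nonneg; rewrite pE pu.
(* Indefiniteness yields vectors of both signs. They make the sets under [inf] and [sup] nonempty,
   and the ratio of each one bounds the set of the opposite sign. *)
have [y py] : exists y, p y < 0.
  case: V_indefinite => /existsNP[y /negP py] _; exists y.
  by move: py; rewrite /= ipVS ler0c -ltNge.
have [x px] : exists x, 0 < p x.
  case: V_indefinite => _ /existsNP[x /negP px]; exists x.
  by move: px; rewrite /= ipVS -[0]/(0%:C) lecR -ltNge.
have pos_ratio u : 0 < p u ->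
    [set form_ratio fK fE T V x | x in [set x | 0 < fE (V x) (V x)]] (q u / p u).
  by move=> pu; exists u; rewrite /= ?ratioE// pE -[0]/(0%:C) ltcR.
have neg_ratio u : p u < 0 ->
    [set form_ratio fK fE T V x | x in [set x | fE (V x) (V x) < 0]] (q u / p u).
  by move=> pu; exists u; rewrite /= ?ratioE// pE -[0]/(0%:C) ltcR.
tfae.
- move=> [_ _ psdA].
  (* Dividing by [p u] gives a lower bound on ratios where [p u > 0] and, with the inequality
     reversed, an upper bound where [p u < 0]. *)
  have qp u : - rho * p u <= q u.
    by have := psdA u; rewrite sumE ler0c; lra.
  apply/andP; split; rewrite /rho_minus /rho_plus.
    rewrite lerNl; apply: lb_le_inf; first by exists (q x / p x); exact: pos_ratio.
    move=> _ [u /= + <-]; rewrite pE -[0]/(0%:C) ltcR => pu.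
    by rewrite ratioE ler_pdivlMr.
  rewrite lerNr; apply: ge_sup; first by exists (q y / p y); exact: neg_ratio.
  move=> _ [u /= + <-]; rewrite pE -[0]/(0%:C) ltcR => pu.
  by rewrite ratioE ler_ndivrMr.
- rewrite /rho_minus /rho_plus => /andP[rho_ge rho_le]; split.
    split; first by apply: mem_set; exists 0; rewrite // !linear0.
    move=> a _ _ /set_mem[u _ <-] /set_mem[v _ <-]; apply: mem_set.
    by exists (a *: u + v); rewrite // !linearP.
  move=> _ [u _ <-]; rewrite prodE ler0c.
  have [pu|pu|pu] := ltgtP (p u) 0; last by rewrite pu mulr0 addr0 q_ge0.
    have : q u / p u <= - rho.
      rewrite lerNr; apply: (le_trans rho_le); rewrite lerN2.
      apply: ub_le_sup; last exact: neg_ratio.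
      (* The supremum dominates its members only if the set is bounded above; the positive vector
         [x] supplies the bound through [form_ratio_le]. *)
      exists (q x / p x) => _ [v /= pv <-]; rewrite -ratioE.
      by apply: form_ratio_le => //; rewrite pE -[0]/(0%:C) ltcR.
    by rewrite ler_ndivrMr//; lra.
  have : - rho <= q u / p u.
    rewrite lerNl; apply: le_trans rho_ge; rewrite lerN2.
    apply: ge_inf; last exact: pos_ratio.
    exists (q y / p y) => _ [v /= pv <-]; rewrite -ratioE.
    by apply: form_ratio_le => //; rewrite pE -[0]/(0%:C) ltcR.
  by rewrite ler_pdivlMr//; lra.
(* Linearity and continuity come from the adjoints; positivity at [u] is nonnegativity of the
   product form at [(T u, V u)]. *)
- move=> [_ range_ge0]; split.
  + move=> a u v /=; rewrite !linearP TSlin VSlin.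
    rewrite !scalerDr !scalerA [rho%:C * a]mulrC addrACA.
    by rewrite -!addrA.
  + move=> u; apply: cvgD.
      by apply: continuous_comp; [exact: T_bounded|exact: TSc].
    apply: cvgZl_tmp.
    by apply: continuous_comp; [exact: V_bounded|exact: VSc].
  + by move=> u; rewrite sumE -prodE; apply: range_ge0; exists u.
Qed.
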